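(* Let $p(x)\in\mathbb{Z}[x]$ be a monic polynomial with even degree, with simple or double roots belonging to the set $\left\{\ldots,-3,-2,-1,\tfrac12,\tfrac32,\tfrac52,\ldots\right\}$, and such that $p(x)=p\left(-\tfrac12-x\right)$. Then $$ \sum_{n\geq 0}\frac{4n+1}{p(n)}\left[\frac{1}{4^n}\binom{2n}{n}\right]^4 $$ is a rational multiple of $\frac{1}{\pi^2}$.
   Context: The set of admissible roots consists of all negative integers together with all positive half-integers $\tfrac12,\tfrac32,\tfrac52,\ldots$. A rational multiple of a real number $c$ means a number of the form $qc$ with $q\in\mathbb{Q}$.
   Formalization: p is taken monic with rational rather than integer coefficients, since no nonconstant monic p in Z[x] meets the conditions, and p is assumed nonconstant, since for p = 1 the series diverges (terms ~ 4/(π²n)). *)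

(* Defs.v *)
From mathcomp Require Import all_boot all_order all_algebra all_field.
From mathcomp Require Import all_classical all_reals all_analysis.
Import Order.TTheory GRing.Theory Num.Theory.
Import numFieldNormedType.Exports.

Set Implicit Arguments.
Unset Strict Implicit.
Unset Printing Implicit Defensive.

Local Open Scope ring_scope.

Definition admissible_root (F : fieldType) (z : F) : Prop :=
  (exists k : nat, z = - k.+1%:R) \/ (exists k : nat, z = k%:R + 2^-1).

(* The coefficients are rational, not integral: a nonconstant monic p with
   integer coefficients is never equal to p (- 1/2 - x), because both r and
   - 1/2 - r would be algebraic integers for any root r.
   All the complex roots are meant, hence the passage to algC; mup z q is the multiplicity of z as a root of q. *)
Definition admissible_simple_or_double_roots (p : {poly rat}) : Prop :=
  let pC : {poly algC} := map_poly ratr p in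
  forall z : algC, root pC z -> admissible_root z /\ (mup z pC <= 2)%N.

Definition rational_multiple (R : realType) (x c : R) : Prop :=
  exists q : rat, x = ratr q * c.

(* The division is by a nonzero number whenever the roots of p are admissible,
   since no natural number is an admissible root. *)
Definition summand (R : realType) (p : {poly rat}) (n : nat) : R :=
  (4 * n%:R + 1) / (map_poly ratr p).[n%:R]
    * (1 / 4 ^+ n * ('C(2 * n, n))%:R) ^+ 4.

(* Main.v *)
Require Import Defs.
From mathcomp Require Import all_boot all_order all_algebra all_field.
From mathcomp Require Import all_classical all_reals all_analysis.
From mathcomp Require Import ring lra zify.
Import Order.TTheory GRing.Theory Num.Theory.
Import numFieldNormedType.Exports.

Local Open Scope classical_set_scope.
Local Open Scope ring_scope.

(* The symmetry pairs the root -k with k - 1/2, so p(n) is a product of factors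
   t - l_k, where t = n (n + 1/2) and l_k = k (k - 1/2), each occurring at most
   twice; partial fractions in t reduce 1/p to 1/(t - l_k) and 1/(t - l_k)^2.
   With u_n = 4^-n binom(2n, n), the sequences
   u_n^4 n^4 / ((n + k) (n - k - 1/2))^i, i = 1, 2, telescope to a recurrence
   from k to k + 1 for the sums of (4n + 1) u_n^4 / (t - l_k)^i, in which the
   terms of index k vanish for k = 0. Their limits are 1/pi^2 for i = 1, by
   Wallis, and 0 for i = 2. *)

(** * Central binomial coefficients and Wallis integrals *)

Definition scaled_central_binom (R : realType) (n : nat) : R :=
  1 / 4 ^+ n * ('C(2 * n, n))%:R.

Lemma scaled_central_binomS (R : realType) (n : nat) :
  scaled_central_binom R n.+1 = scaled_central_binom R n * (n%:R + 2^-1) / n.+1%:R.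
Proof.
have E : (n.+1 * 'C(2 * n.+1, n.+1) = 2 * (2 * n).+1 * 'C(2 * n, n))%N.
  have H1 := mul_bin_diag (2 * n.+1) n.
  have H2 := mul_bin_down (2 * n).+1 n.
  have e1 : (2 * n.+1 = (2 * n).+2)%N by lia.
  rewrite e1 /= in H1 *; rewrite /= in H2.
  have e2 : ((2 * n).+1 - n = n.+1)%N by lia.
  rewrite e2 in H2.
  (* The factor n + 1 lets the two absorption identities be chained without division. *)
  apply/eqP; rewrite -(@eqn_pmul2l n.+1) //; apply/eqP.
  have -> : (n.+1 * (2 * (2 * n).+1 * 'C(2 * n, n)) =
             n.+1 * 2 * ((2 * n).+1 * 'C(2 * n, n)))%N by lia.
  by rewrite -H1 H2; lia.
have ER : n.+1%:R * ('C(2 * n.+1, n.+1))%:R =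
    2 * (2 * n%:R + 1) * ('C(2 * n, n))%:R :> R.
  by have := congr1 (fun m => m%:R : R) E; rewrite !natrM -(natr1 (2 * n)) natrM.
have n0 : n.+1%:R != 0 :> R by rewrite pnatr_eq0.
rewrite /scaled_central_binom exprS.
have -> : ('C(2 * n.+1, n.+1))%:R =
    2 * (2 * n%:R + 1) * ('C(2 * n, n))%:R / n.+1%:R :> R.
  by rewrite -ER mulrAC mulfV // mul1r.
rewrite -natr1 in n0 *.
by field; rewrite n0 expf_neq0.
Qed.

Lemma scaled_central_binom_gt0 (R : realType) (n : nat) : 0 < scaled_central_binom R n.
Proof.
by rewrite mulr_gt0 ?ltr0n ?bin_gt0 ?mul2n -?addnn ?leq_addr // divr_gt0 // exprn_gt0.
Qed.

(* The reduction formula for the integral of sin ^+ n, so that Wallis'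
   inequalities need derivatives only. *)
Fixpoint sin_primitive (R : realType) (n : nat) : R -> R :=
  match n with
  | 0 => id
  | 1 => fun x => - cos x
  | m.+2 => fun x => (m.+1%:R * sin_primitive R m x
                      - sin x ^+ m.+1 * cos x) / m.+2%:R
  end.

Lemma is_derive_sin_primitive (R : realType) (n : nat) (x : R) :
  is_derive x 1 (sin_primitive R n) (sin x ^+ n).
Proof.
have [m] := ubnP n; elim: m n => // m IH [|[|n]] /ltnSE nm /=.
- by rewrite expr0; exact: is_derive_id.
- by apply: is_derive_eq; rewrite opprK expr1.
- have IHn : is_derive x 1 (sin_primitive R n) (sin x ^+ n).
    by apply: IH; apply: leq_trans nm.
  have := is_deriveX n.+1 (is_derive_sin x) => HX.
  have H1 := is_deriveM HX (is_derive_cos x).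
  have H2 := is_deriveB (is_deriveZ n.+1%:R IHn) H1.
  have H3 := is_deriveZ n.+2%:R^-1 H2.
  have -> : (fun y : R => (n.+1%:R * sin_primitive R n y
      - sin y ^+ n.+1 * cos y) / n.+2%:R) =
      (n.+2%:R^-1 \*: (n.+1%:R \*: sin_primitive R n - sin ^+ n.+1 * cos)).
    by apply/funext => y; rewrite mulrC !fctE.
  suff <- : n.+2%:R^-1 *: (n.+1%:R *: sin x ^+ n -
      ((sin ^+ n.+1) x *: - sin x +
       cos x *: ((n.+1%:R * sin x ^+ n) *: cos x))) = sin x ^+ n.+2 by [].
  have c2 : cos x ^+ 2 = 1 - sin x ^+ 2 by rewrite -(cos2Dsin2 x) addrK.
  have -> : (sin ^+ n.+1) x = sin x ^+ n.+1 by rewrite fctE.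
  rewrite /GRing.scale /= -(natr1 n.+1) -(natr1 n) !exprS.
  have n0 : n.+2%:R != 0 :> R by rewrite pnatr_eq0.
  move: n0; rewrite -(natr1 n.+1) -(natr1 n) => n0.
  field : c2.
  by [].
Qed.

(** The integral of sin ^+ n over [0, pi/2]. *)
Definition wallis (R : realType) (n : nat) : R :=
  sin_primitive R n (pi / 2) - sin_primitive R n 0.

(** The boundary term sin^(n+1) cos vanishes at both endpoints. *)
Lemma wallisSS (R : realType) (n : nat) :
  wallis R n.+2 = n.+1%:R / n.+2%:R * wallis R n.
Proof.
rewrite /wallis /= cos_pihalf sin0 expr0n /= mulr0 mul0r !subr0.
by rewrite -mulrBl -mulrBr mulrAC.
Qed.

(** The difference of the two primitives has derivative sin^n (1 - sin), which is nonnegative on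
    [0, pi/2]. *)
Lemma wallis_nincr (R : realType) (n : nat) : wallis R n.+1 <= wallis R n.
Proof.
pose D : R -> R := sin_primitive R n - sin_primitive R n.+1.
have HD (x : R) : is_derive x 1 D (sin x ^+ n - sin x ^+ n.+1).
  by apply: is_deriveB; exact: is_derive_sin_primitive.
suff : D 0 <= D (pi / 2).
  rewrite /D /wallis !fctE; lra.
have pi0 := pi_ge0 R.
apply: (@ger0_derive1_ndecr R D 0 (pi / 2)) => //.
- move=> x; rewrite in_itv /= => /andP[x0 xpi].
  rewrite derive1E (@derive_val _ _ _ _ _ _ _ (HD x)).
  have s0 : 0 <= sin x by apply: sin_ge0_pi; lra.
  by rewrite exprS -{1}[_ ^+ n]mul1r -mulrBl mulr_ge0 ?exprn_ge0 // subr_ge0 sin_le1.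
- apply: derivable_within_continuous => x _; exact: (@ex_derive _ _ _ _ _ _ _ (HD x)).
- lra.
Qed.

Lemma wallis_even (R : realType) (n : nat) :
  wallis R (2 * n) = scaled_central_binom R n * (pi / 2).
Proof.
elim: n => [|n IH].
  by rewrite /wallis /scaled_central_binom /= subr0 bin0 expr0 divr1 !mul1r.
have -> : (2 * n.+1 = (2 * n).+2)%N by lia.
rewrite wallisSS IH scaled_central_binomS.
have n0 : n.+1%:R != 0 :> R by rewrite pnatr_eq0.
have e : (2 * n).+2%:R = 2 * n.+1%:R :> R by rewrite -natrM; congr (_%:R); lia.
rewrite e -(natr1 (2 * n)) natrM.
by field.
Qed.

Lemma wallis_odd (R : realType) (n : nat) :
  wallis R (2 * n).+1 = ((2 * n%:R + 1) * scaled_central_binom R n)^-1.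
Proof.
elim: n => [|n IH].
  rewrite /wallis /scaled_central_binom /= cos_pihalf cos0 bin0 expr0 divr1.
  by rewrite oppr0 sub0r opprK mulr0 add0r !mul1r invr1.
have -> : (2 * n.+1 = (2 * n).+2)%N by lia.
rewrite wallisSS IH scaled_central_binomS.
have e : (2 * n).+2%:R = 2 * (n%:R + 1) :> R by rewrite natr1 -natrM; congr (_%:R); lia.
have u0 : scaled_central_binom R n != 0 by rewrite gt_eqF ?scaled_central_binom_gt0.
have n0 : 0 <= n%:R :> R by [].
rewrite -(natr1 (2 * n).+2) e -natr1.
field.
by rewrite u0 /=; do !(apply/andP; split); apply: lt0r_neq0; lra.
Qed.

(** Even integrals are proportional to u and odd ones to 1/u, so comparing the integral of index 2n
    + 2 with its two neighbours bounds the square of u. *)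
Lemma scaled_central_binom_sqr_bounds (R : realType) (n : nat) :
  2 / (pi * (2 * n.+1%:R + 1)) <= scaled_central_binom R n.+1 ^+ 2
    <= 1 / (pi * n.+1%:R).
Proof.
have u0 := scaled_central_binom_gt0 R n.+1.
have p0 := pi_gt0 R.
have n0 : 0 <= n%:R :> R by [].
have H1 := wallis_nincr R (2 * n.+1).
have H2 := wallis_nincr R (2 * n).+1.
have e : (2 * n.+1 = (2 * n).+2)%N by lia.
rewrite -e in H2.
rewrite wallis_even wallis_odd in H1.
(* (2n + 1) u_n = 2 (n + 1) u_(n+1) brings this integral to the index n + 1 of the other two. *)
have W : wallis R (2 * n).+1 = (2 * (n%:R + 1) * scaled_central_binom R n.+1)^-1.
  rewrite wallis_odd scaled_central_binomS -natr1; congr (_^-1).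
  by field; apply: lt0r_neq0; lra.
rewrite W wallis_even in H2.
rewrite -(natr1 n) in H1 *.
move: (scaled_central_binom R n.+1) u0 H1 H2 => u u0 H1 H2.
apply/andP; split.
  rewrite ler_pdivrMr; last by rewrite mulr_gt0 //; lra.
  move: H1; rewrite -[leLHS]div1r ler_pdivrMr; last by rewrite mulr_gt0 //; lra.
  by move=> H1; lra.
rewrite ler_pdivlMr; last by rewrite mulr_gt0 //; lra.
move: H2; rewrite -[leRHS]div1r ler_pdivlMr; last by rewrite mulr_gt0 //; lra.
by move=> H2; lra.
Qed.

(** * Asymptotics of the central binomial coefficients *)

Lemma cvg_natr_shift (R : realType) (c : R) :
  (fun n => n%:R / (n%:R + c)) @ \oo --> (1 : R).
Proof.
have H0 : (fun n => n%:R^-1) @ \oo --> (0 : R).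
  by rewrite -(cvg_shiftS (fun n => n%:R^-1 : R)); exact: cvg_harmonic.
have H1 : (fun n => (1 + c * n%:R^-1)^-1) @ \oo --> (1 : R).
  rewrite -[X in _ --> X]invr1; apply: cvgV; first exact: oner_neq0.
  rewrite -[X in _ --> X]addr0 -(mulr0 c); apply: cvgD; first exact: cvg_cst.
  exact: cvgMl_tmp.
apply: cvg_trans H1; apply: near_eq_cvg.
near=> n.
have n0 : n%:R != 0 :> R by rewrite pnatr_eq0 -lt0n; near: n; exact: nbhs_infty_gt.
have -> : n%:R + c = n%:R * (1 + c / n%:R) by rewrite mulrDr mulr1 mulrCA mulfV ?mulr1.
by rewrite invfM mulrA mulfV // mul1r.
Unshelve. all: by end_near.
Qed.

Lemma cvg_inv_natr_shift (R : realType) (c : R) :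
  (fun n => (n%:R + c)^-1) @ \oo --> (0 : R).
Proof.
have H0 : (fun n => n%:R^-1) @ \oo --> (0 : R).
  by rewrite -(cvg_shiftS (fun n => n%:R^-1 : R)); exact: cvg_harmonic.
have := cvgM H0 (cvg_natr_shift R c); rewrite mul0r => L.
apply: cvg_trans (L _); apply: near_eq_cvg; near=> n.
have n0 : n%:R != 0 :> R by rewrite pnatr_eq0 -lt0n; near: n; exact: nbhs_infty_gt.
by rewrite /= mulrA mulVf // mul1r.
Unshelve. all: by end_near.
Qed.

Lemma cvg_scaled_central_binom (R : realType) :
  (fun n => n%:R * scaled_central_binom R n ^+ 2) @ \oo --> (pi^-1 : R).
Proof.
(* The lower bound, multiplied by n, is exactly this sequence; the upper one becomes the constant
   1/pi. *)
have H : (fun n => pi^-1 * (n%:R / (n%:R + 2^-1))) @ \oo --> (pi^-1 : R).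
  rewrite -[X in _ --> X]mulr1; apply: cvgMl_tmp; exact: cvg_natr_shift.
apply: (squeeze_cvgr _ H); last exact: cvg_cst.
near=> n.
have n_gt0 : (0 < n)%N by near: n; exact: nbhs_infty_gt.
rewrite -(prednK n_gt0); move: n.-1 => {n_gt0} m.
have p0 := pi_gt0 R.
have m0 : 0 <= m%:R :> R by [].
have m1 : 0 < m.+1%:R :> R by [].
have /andP[H1 H2] := scaled_central_binom_sqr_bounds R m.
apply/andP; split.
  apply: le_trans (ler_wpM2l (ltW m1) H1).
  rewrite le_eqVlt; apply/orP; left; apply/eqP; field.
  by do !(apply/andP; split); apply: lt0r_neq0; lra.
apply: le_trans (ler_wpM2l (ltW m1) H2) _.
rewrite le_eqVlt; apply/orP; left; apply/eqP; field.
by do !(apply/andP; split); apply: lt0r_neq0; lra.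
Unshelve. all: by end_near.
Qed.

(** * Series whose sums are rational multiples of 1/pi^2 *)

(** The summand with f n in place of 1 / p(n), so that decomposing 1 / p acts on f alone. *)
Definition weighted (R : realType) (f : nat -> R) (n : nat) : R :=
  (4 * n%:R + 1) * scaled_central_binom R n ^+ 4 * f n.

(** Convergence is part of the predicate, so that closure under rational linear combinations carries
    both conclusions of the theorem. *)
Definition pi_rational (R : realType) (f : nat -> R) : Prop :=
  exists q : rat, series (weighted R f) @ \oo --> (ratr q / pi ^+ 2 : R).

Lemma pi_rationalD (R : realType) (f g : nat -> R) :
  pi_rational R f -> pi_rational R g -> pi_rational R (fun n => f n + g n).
Proof.
move=> [a Ha] [b Hb]; exists (a + b).
have -> : weighted R (fun n => f n + g n) = weighted R f + weighted R g.
  by apply/funext => n; rewrite /weighted mulrDr.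
rewrite rmorphD mulrDl seriesD; exact: cvgD.
Qed.

Lemma pi_rationalZ (R : realType) (c : rat) (f : nat -> R) :
  pi_rational R f -> pi_rational R (fun n => ratr c * f n).
Proof.
move=> [a Ha]; exists (c * a).
have -> : weighted R (fun n => ratr c * f n) = ratr c *: weighted R f.
  by apply/funext => n; rewrite /weighted mulrCA.
rewrite rmorphM -mulrA seriesZ; exact: cvgMl_tmp.
Qed.

(** The condition at 0 makes G itself the sequence of partial sums. *)
Lemma pi_rational_telescope (R : realType) (q : rat) (f G : nat -> R) :
  G 0 = 0 -> G @ \oo --> (ratr q / pi ^+ 2 : R) ->
  (forall n, weighted R f n = G n.+1 - G n) -> pi_rational R f.
Proof.
move=> G0 HG E; exists q.
have -> : weighted R f = telescope G by apply/funext.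
have -> // : series (telescope G) = G.
by rewrite telescopeK; apply/funext => n /=; rewrite G0 subr0.
Qed.

(** * Telescoping sequences and their differences *)

(** Doubling would equate an even and an odd number. *)
Lemma sub_half_neq0 (R : realType) (a b : nat) : a%:R - b%:R - 2^-1 != 0 :> R.
Proof.
apply/eqP => H.
have : (2 * a)%:R = (2 * b).+1%:R :> R.
  by rewrite -natr1 !natrM; lra.
by move/eqP; rewrite eqr_nat => /eqP; lia.
Qed.

Lemma add_half_neq0 (R : realType) (a b : nat) : a%:R - b%:R + 2^-1 != 0 :> R.
Proof. by rewrite -oppr_eq0 opprD opprB sub_half_neq0. Qed.

(* (n + k) (n - k + 1/2) = n (n + 1/2) - k (k - 1/2) *)
Definition quad (R : realType) (k n : nat) : R :=
  (n%:R + k%:R) * (n%:R - k%:R + 2^-1).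

Lemma quadS_neq0 (R : realType) (k n : nat) : quad R k.+1 n != 0.
Proof. by rewrite mulf_neq0 ?add_half_neq0 // -natrD pnatr_eq0 addnS. Qed.

(* Since (n + 1)^4 u_(n+1)^4 = (n + 1/2)^4 u_n^4 and the rational factor is
   invariant under n -> 1/2 - n, the forward difference is (4 n + 1) u_n^4 times
   a rational function of n (n + 1/2), with poles at the roots of quad k and
   quad (k + 1) only. *)
Definition antidiff (R : realType) (i k n : nat) : R :=
  scaled_central_binom R n ^+ 4 * n%:R ^+ 4
    / ((n%:R + k%:R) * (n%:R - k%:R - 2^-1)) ^+ i.

Lemma antidiffS (R : realType) (i k n : nat) :
  antidiff R i k n.+1 = scaled_central_binom R n ^+ 4 *
    ((n%:R + 2^-1) ^+ 4 / ((n%:R + k%:R + 1) * (n%:R - k%:R + 2^-1)) ^+ i).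
Proof.
have n0 : n.+1%:R != 0 :> R by rewrite pnatr_eq0.
rewrite /antidiff -exprMn scaled_central_binomS divfK // exprMn -mulrA -(natr1 n).
by congr (_ * (_ / (_ * _) ^+ _)); lra.
Qed.

(** The sequence is the square of n u_n^2 times n / (n + k) times n / (n - k - 1/2). *)
Lemma cvg_antidiff1 (R : realType) (k : nat) :
  antidiff R 1 k @ \oo --> (pi ^- 2 : R).
Proof.
have H := cvg_scaled_central_binom R.
have := cvgM (cvgM (cvgM H H) (cvg_natr_shift R k%:R))
  (cvg_natr_shift R (- k%:R - 2^-1)).
rewrite !mulr1 -invfM -expr2 => L.
apply: cvg_trans (L _ _ _); apply: near_eq_cvg; apply: nearW => n.
rewrite /= /antidiff addrA invfM; ring.
Qed.

(** Compared with i = 1 there is an extra factor 1 / ((n + k) (n - k - 1/2)), which tends to 0. *)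
Lemma cvg_antidiff2 (R : realType) (k : nat) :
  antidiff R 2 k @ \oo --> (0 : R).
Proof.
have := cvgM (cvgM (cvg_antidiff1 R k) (cvg_inv_natr_shift R k%:R))
  (cvg_inv_natr_shift R (- k%:R - 2^-1)).
rewrite !mulr0 => L.
apply: cvg_trans (L _ _); apply: near_eq_cvg; apply: nearW => n.
by rewrite /= /antidiff addrA expr1 expr2 !invfM !mulrA.
Qed.

(* The coefficients are the partial fraction coefficients. The identity also
   holds at n = k = 0, where 1 / quad is the junk value 0. *)
Lemma antidiff_diff1 (R : realType) (k n : nat) :
  antidiff R 1 k n.+1 - antidiff R 1 k n =
  (4 * n%:R + 1) * scaled_central_binom R n ^+ 4 *
    (k%:R ^+ 4 / (4 * k%:R + 1) * (quad R k n)^-1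
     - (k%:R + 2^-1) ^+ 4 / (4 * k%:R + 1) * (quad R k.+1 n)^-1).
Proof.
rewrite antidiffS /antidiff /quad -mulrA -mulrBr [RHS]mulrAC [RHS]mulrC; congr (_ * _).
have d1 := sub_half_neq0 R n k.
have d2 := add_half_neq0 R n k.
have d3 : n%:R + k%:R + 1 != 0 :> R by rewrite -natrD natr1 pnatr_eq0.
have d4 : 4 * k%:R + 1 != 0 :> R by rewrite -natrM natr1 pnatr_eq0.
have d5 : n%:R - (k%:R + 1) + 2^-1 != 0 :> R.
  by apply: contraNneq d1 => d; apply/eqP; lra.
rewrite -(natr1 k).
(* [n + k] vanishes only at n = k = 0; there the zero factors n^4 and k^4 multiply every default
   inverse. *)
have [/eqP nk0|d6] := eqVneq (n + k)%N 0%N.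
  move: nk0 d1 d2 d5; rewrite addn_eq0 => /andP[/eqP -> /eqP ->] _ _ _.
  by rewrite !(add0r, addr0, mul0r, mulr0, subr0, expr0n, expr1) /=; field.
have {}d6 : n%:R + k%:R != 0 :> R by rewrite -natrD pnatr_eq0.
have c1 : (n%:R - (k%:R + 1)) * 2 + 1 != 0 :> R.
  by apply: contraNneq d1 => d; apply/eqP; lra.
have c2 : (n%:R - k%:R) * 2 + 1 != 0 :> R.
  by apply: contraNneq d2 => d; apply/eqP; lra.
by field; rewrite c1 addrA d3 d4 c2.
Qed.

(** Squaring the denominators gives double poles, hence two coefficients for each quadratic. Those
    of [quad R k] contain k^3 and vanish at k = 0. *)
Lemma antidiff_diff2 (R : realType) (k n : nat) :
  antidiff R 2 k n.+1 - antidiff R 2 k n =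
  (4 * n%:R + 1) * scaled_central_binom R n ^+ 4 *
    (k%:R ^+ 4 * (4 * k%:R - 1) / (4 * k%:R + 1) ^+ 2 * (quad R k n)^-1 ^+ 2
     + 8 * k%:R ^+ 3 * (3 * k%:R + 1) / (4 * k%:R + 1) ^+ 3 * (quad R k n)^-1
     - (k%:R + 2^-1) ^+ 4 * (4 * k%:R + 3) / (4 * k%:R + 1) ^+ 2
         * (quad R k.+1 n)^-1 ^+ 2
     - (2 * k%:R + 1) ^+ 3 * (6 * k%:R + 1) / (2 * (4 * k%:R + 1) ^+ 3)
         * (quad R k.+1 n)^-1).
Proof.
rewrite antidiffS /antidiff /quad -mulrA -mulrBr [RHS]mulrAC [RHS]mulrC; congr (_ * _).
have d1 := sub_half_neq0 R n k.
have d2 := add_half_neq0 R n k.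
have d3 : n%:R + k%:R + 1 != 0 :> R by rewrite -natrD natr1 pnatr_eq0.
have d4 : 4 * k%:R + 1 != 0 :> R by rewrite -natrM natr1 pnatr_eq0.
have d5 : n%:R - (k%:R + 1) + 2^-1 != 0 :> R.
  by apply: contraNneq d1 => d; apply/eqP; lra.
rewrite -(natr1 k).
have [/eqP nk0|d6] := eqVneq (n + k)%N 0%N.
  move: nk0 d1 d2 d5; rewrite addn_eq0 => /andP[/eqP -> /eqP ->] _ _ _.
  by rewrite !(add0r, addr0, mul0r, mulr0, subr0, expr0n, expr1) /=; field.
have {}d6 : n%:R + k%:R != 0 :> R by rewrite -natrD pnatr_eq0.
have c1 : (n%:R - (k%:R + 1)) * 2 + 1 != 0 :> R.
  by apply: contraNneq d1 => d; apply/eqP; lra.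
have c2 : (n%:R - k%:R) * 2 + 1 != 0 :> R.
  by apply: contraNneq d2 => d; apply/eqP; lra.
by field; rewrite c1 addrA d3 d4 c2.
Qed.

(** * Sums for one quadratic factor and for its square *)

(** A multirule that pushes [ratr] down to the atoms of the rational coefficients in one rewrite. *)
Lemma ratr_morph (R : realType) :
  (forall n : nat, ratr n%:R = n%:R :> R) * (ratr 1 = 1 :> R) *
  (forall x (n : nat), ratr (x ^+ n) = ratr x ^+ n :> R) *
  {morph ratr : x / - x >-> - x : R} * {morph ratr : x / x^-1 >-> x^-1 : R} *
  {morph ratr : x y / x + y >-> x + y : R} *
  {morph ratr : x y / x * y >-> x * y : R}.
Proof.
do !split; [exact: ratr_nat|exact: rmorph1|by move=> x n; exact: rmorphXn|
  exact: rmorphN|exact: fmorphV|exact: rmorphD|exact: rmorphM].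
Qed.

(** The recurrence solved for its new term: f is the telescoped sum, g collects the terms already
    summed, h is the unknown. *)
Lemma pi_rational_solve (R : realType) (b : rat) (f g h : nat -> R) :
  b != 0 -> pi_rational R f -> pi_rational R g ->
  (forall n, f n = g n + ratr b * h n) -> pi_rational R h.
Proof.
move=> b0 Hf Hg E.
have -> : h = (fun n => ratr b^-1 * (f n + ratr (-1) * g n)).
  apply/funext => n; rewrite E rmorphN1 mulN1r addrAC subrr add0r mulrA.
  by rewrite -rmorphM mulVf // rmorph1 mul1r.
apply: pi_rationalZ; apply: pi_rationalD => //; exact: pi_rationalZ.
Qed.

(** Starts the recurrence: at k = 0 nothing is known of the sum of f, but its coefficient
    vanishes. *)
Lemma pi_rational_scale0 (R : realType) (c : rat) (k : nat) (f : nat -> R) :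
  (k = 0%N -> c = 0) -> ((0 < k)%N -> pi_rational R f) ->
  pi_rational R (fun n => ratr c * f n).
Proof.
case: k => [c0 _|k _ Hf]; last by apply: pi_rationalZ; exact: Hf.
have -> : (fun n => ratr c * f n) = (fun=> 0).
  by apply/funext => n; rewrite c0 // rmorph0 mul0r.
apply: (pi_rational_telescope R 0 _ (fun=> 0)) => //.
  by rewrite rmorph0 mul0r; exact: cvg_cst.
by move=> n; rewrite /weighted mulr0 subrr.
Qed.

Lemma pi_rational_quad1 (R : realType) (k : nat) :
  pi_rational R (fun n => (quad R k.+1 n)^-1).
Proof.
(* For m = 0 the claim is vacuous, so the step to 1 has to do without an induction hypothesis. *)
suff H m : (0 < m)%N -> pi_rational R (fun n => (quad R m n)^-1) by exact: H.
elim: m => // {}k IH _.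
pose a : rat := k%:R ^+ 4 / (4 * k%:R + 1).
pose b : rat := - ((k%:R + 2^-1) ^+ 4 / (4 * k%:R + 1)).
have b0 : b != 0.
  rewrite oppr_eq0 mulf_neq0 ?expf_neq0 ?invr_eq0 //; apply: lt0r_neq0;
  have := ler0n rat k; lra.
have Ha : ratr a = k%:R ^+ 4 / (4 * k%:R + 1) :> R.
  by rewrite !ratr_morph.
have Hb : ratr b = - ((k%:R + 2^-1) ^+ 4 / (4 * k%:R + 1)) :> R.
  by rewrite !ratr_morph.
pose f n : R := ratr a * (quad R k n)^-1 + ratr b * (quad R k.+1 n)^-1.
apply: (pi_rational_solve R b f (fun n => ratr a * (quad R k n)^-1)) => //.
  apply: (pi_rational_telescope R 1 f (antidiff R 1 k)).
  - by rewrite /antidiff expr0n mulr0 mul0r.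
  - by rewrite rmorph1 mul1r; exact: cvg_antidiff1.
  - by move=> n; rewrite antidiff_diff1 /weighted /f Ha Hb mulNr.
apply: (pi_rational_scale0 R _ k) => // k0.
by rewrite /a k0 expr0n mul0r.
Qed.

(** The recurrence for i = 2 also involves first powers, already summed; the telescoped sum itself
    is 0. *)
Lemma pi_rational_quad2 (R : realType) (k : nat) :
  pi_rational R (fun n => (quad R k.+1 n)^-1 ^+ 2).
Proof.
suff H m : (0 < m)%N -> pi_rational R (fun n => (quad R m n)^-1 ^+ 2) by exact: H.
elim: m => // {}k IH _.
pose a : rat := k%:R ^+ 4 * (4 * k%:R - 1) / (4 * k%:R + 1) ^+ 2.
pose a' : rat := 8 * k%:R ^+ 3 * (3 * k%:R + 1) / (4 * k%:R + 1) ^+ 3.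
pose b : rat := - ((k%:R + 2^-1) ^+ 4 * (4 * k%:R + 3) / (4 * k%:R + 1) ^+ 2).
pose b' : rat :=
  - ((2 * k%:R + 1) ^+ 3 * (6 * k%:R + 1) / (2 * (4 * k%:R + 1) ^+ 3)).
have b0 : b != 0.
  have := ler0n rat k => ?.
  by rewrite oppr_eq0 !mulf_neq0 ?invr_eq0 ?expf_neq0 //; apply: lt0r_neq0; lra.
have Ha : ratr a = k%:R ^+ 4 * (4 * k%:R - 1) / (4 * k%:R + 1) ^+ 2 :> R.
  by rewrite !ratr_morph.
have Ha' : ratr a' = 8 * k%:R ^+ 3 * (3 * k%:R + 1) / (4 * k%:R + 1) ^+ 3 :> R.
  by rewrite !ratr_morph.
have Hb : ratr b =
    - ((k%:R + 2^-1) ^+ 4 * (4 * k%:R + 3) / (4 * k%:R + 1) ^+ 2) :> R.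
  by rewrite !ratr_morph.
have Hb' : ratr b' =
    - ((2 * k%:R + 1) ^+ 3 * (6 * k%:R + 1) / (2 * (4 * k%:R + 1) ^+ 3)) :> R.
  by rewrite !ratr_morph.
pose g n : R := ratr a * (quad R k n)^-1 ^+ 2 + ratr a' * (quad R k n)^-1
  + ratr b' * (quad R k.+1 n)^-1.
pose f n : R := g n + ratr b * (quad R k.+1 n)^-1 ^+ 2.
apply: (pi_rational_solve R b f g) => //.
  apply: (pi_rational_telescope R 0 f (antidiff R 2 k)).
  - by rewrite /antidiff expr0n mulr0 mul0r.
  - by rewrite rmorph0 mul0r; exact: cvg_antidiff2.
  - by move=> n; rewrite antidiff_diff2 /weighted /f /g Ha Ha' Hb Hb' !mulNr [in LHS]addrAC.
apply: pi_rationalD; last exact/pi_rationalZ/pi_rational_quad1.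
apply: pi_rationalD; apply: (pi_rational_scale0 R _ k) => //.
- by move=> k0; rewrite /a k0 expr0n !mul0r.
- by move=> k0; rewrite /a' k0 expr0n mulr0 !mul0r.
- by case: k {IH a a' b b' b0 Ha Ha' Hb Hb' g f} => // k _; exact: pi_rational_quad1.
Qed.

(** * Partial fractions for products of quadratics *)

(** Both quadratics are n (n + 1/2) minus a constant, so n cancels. *)
Lemma quad_sub (R : realType) (a b n : nat) :
  quad R b.+1 n - quad R a.+1 n =
  ratr ((a%:R - b%:R) * (a%:R + b%:R + 2^-1 * 3)).
Proof.
rewrite !ratr_morph /quad -(natr1 a) -(natr1 b).
by field.
Qed.

(** Distinct factors x and y satisfy 1/(xy) = (1/x - 1/y)/(y - x) with y - x a nonzero rational
    constant, so the product splits into two shorter ones. The process stops when all factors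
    coincide, and then there are one or two of them. *)
Lemma pi_rational_quad_prod (R : realType) (s : seq nat) :
  s != [::] -> (forall k, (count_mem k s <= 2)%N) ->
  pi_rational R (fun n => \prod_(k <- s) (quad R k.+1 n)^-1).
Proof.
have [m] := ubnP (size s); elim: m s => // m IH [|a s] //= /ltnSE sm _ Hc.
have [/all_pred1P Es|/allPn[b bs /= ba]] := boolP (all (pred1 a) s).
  have := Hc a; rewrite Es /= eqxx count_nseq /= eqxx mul1n.
  case: (size s) => [|[|//]] _ /=.
    rewrite (_ : (fun n => _) = (fun n => (quad R a.+1 n)^-1)).
      exact: pi_rational_quad1.
    by apply/funext => n; rewrite big_seq1.
  rewrite (_ : (fun n => _) = (fun n => (quad R a.+1 n)^-1 ^+ 2)).
    exact: pi_rational_quad2.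
  by apply/funext => n; rewrite big_cons big_seq1.
have ps := perm_to_rem bs.
set r := rem b s in ps.
have sr : ((size r).+1 < m)%N by rewrite (perm_size ps) in sm.
have Hc' k : ((a == k) + ((b == k) + count_mem k r) <= 2)%N.
  by have := Hc k; rewrite (permP ps).
pose c : rat := (a%:R - b%:R) * (a%:R + b%:R + 2^-1 * 3).
have c0 : c != 0.
  apply: mulf_neq0; first by rewrite subr_eq0 eqr_nat eq_sym.
  by apply: lt0r_neq0; have := ler0n rat a; have := ler0n rat b; lra.
have -> : (fun n => \prod_(k <- a :: s) (quad R k.+1 n)^-1) =
    (fun n => ratr c^-1 * (\prod_(k <- a :: r) (quad R k.+1 n)^-1
               + ratr (-1) * \prod_(k <- b :: r) (quad R k.+1 n)^-1)).
  apply/funext => n.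
  rewrite !big_cons (perm_big _ ps) big_cons rmorphN1 mulN1r -mulrBl.
  have -> : ratr c^-1 = (quad R b.+1 n - quad R a.+1 n)^-1 :> R.
    by rewrite quad_sub fmorphV.
  have := quadS_neq0 R a n; have := quadS_neq0 R b n.
  have : quad R b.+1 n - quad R a.+1 n != 0 by rewrite quad_sub fmorph_eq0.
  move: (\prod_(k <- r) _) (quad R a.+1 n) (quad R b.+1 n) => P x y d y0 x0 /=.
  by field; rewrite x0 y0 d.
apply/pi_rationalZ/pi_rationalD; last apply/pi_rationalZ; apply: IH => //=.
- by move=> k; apply: leq_trans (Hc' k); rewrite leq_add2l leq_addl.
- by move=> k; apply: leq_trans (Hc' k); exact: leq_addl.
Qed.

(** * Factorization of the symmetric polynomial *)

(** The roots -(k + 1) and k + 1/2 are exchanged by x -> -1/2 - x, and the value at n is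
    [quad R k.+1 n]. The shift makes every natural number a valid index. *)
Definition symmetric_quadratic (k : nat) : {poly rat} :=
  ('X + k.+1%:R%:P) * ('X - (k%:R + 2^-1)%:P).

Lemma symmetric_quadratic_reflect (k : nat) :
  symmetric_quadratic k \Po ((- 2^-1)%:P - 'X) = symmetric_quadratic k.
Proof.
rewrite /symmetric_quadratic comp_polyM comp_polyB comp_polyD !comp_polyC comp_polyX.
rewrite -(natr1 k) !polyCD !polyCN.
have : ((2^-1)%:P : {poly rat}) *+ 2 = 1.
  by rewrite -polyCMn -(mulr_natr 2^-1) mulVf.
move: (2^-1)%:P (k%:R)%:P => h K hE.
(* [ring] cannot see that h is a half; with 1 written as 2h the identity holds for arbitrary h. *)
have -> : (1 : rat)%:P = h *+ 2 by [].
ring.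
Qed.

Lemma symmetric_quadratic_monic (k : nat) : symmetric_quadratic k \is monic.
Proof. by rewrite monicMl ?monicXsubC // monicE lead_coefXaddC. Qed.

Lemma size_symmetric_quadratic (k : nat) : size (symmetric_quadratic k) = 3%N.
Proof.
rewrite size_monicM ?size_XaddC ?size_XsubC ?polyXsubC_eq0 //.
by rewrite monicE lead_coefXaddC.
Qed.

(** An admissible root is rational, so it descends from [algC] to p; the symmetry yields its
    partner, and the two linear factors are coprime. *)
Lemma symmetric_quadratic_dvd (p : {poly rat}) (z : algC) :
  p = p \Po ((- 2^-1)%:P - 'X) -> root (map_poly ratr p) z -> admissible_root z ->
  exists k, symmetric_quadratic k %| p.
Proof.
move=> sym rz hz.
suff [k rk] : exists k : nat, root p (- k.+1%:R).
  exists k.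
  have rk' : root p (k%:R + 2^-1).
    rewrite sym root_comp !hornerE (_ : _ - _ = - k.+1%:R) //.
    by rewrite -(natr1 k); field.
  rewrite Gauss_dvdp.
    by rewrite -[k.+1%:R]opprK polyCN !dvdp_XsubCl rk.
  by rewrite -[k.+1%:R]opprK polyCN coprimep_XsubC2.
have rr (x : rat) : z = ratr x -> root p x.
  by move=> zE; rewrite zE fmorph_root in rz.
case: hz => -[k zE]; exists k.
  by apply: rr; rewrite zE rmorphN /= ratr_nat.
rewrite sym root_comp !hornerE (_ : _ - _ = k%:R + 2^-1); last first.
  by rewrite -(natr1 k); field.
by apply: rr; rewrite zE rmorphD fmorphV /= !ratr_nat.
Qed.

(** Induction on the size: dividing by one quadratic keeps p monic, symmetric and with admissible
    roots. *)
Lemma symmetric_factorization (p : {poly rat}) :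
  p \is monic -> p = p \Po ((- 2^-1)%:P - 'X) ->
  (forall z : algC, root (map_poly ratr p) z -> admissible_root z) ->
  exists s : seq nat, p = \prod_(k <- s) symmetric_quadratic k.
Proof.
have [m] := ubnP (size p); elim: m p => // m IH p /ltnSE sm pm sym adm.
have [s1|s1] := leqP (size p) 1%N.
  exists [::]; rewrite big_nil.
  by move/size1_polyC: s1 pm => ->; rewrite monicE lead_coefC => /eqP ->.
have [z rz] : exists z : algC, root (map_poly ratr p) z.
  by apply: closed_rootP; rewrite size_map_poly neq_ltn s1 orbT.
have [k /dvdpP[q pE]] := symmetric_quadratic_dvd p z sym rz (adm z rz).
have km := symmetric_quadratic_monic k.
have qm : q \is monic by rewrite -(monicMr _ km) -pE.
have qsym : q = q \Po ((- 2^-1)%:P - 'X).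
  apply: (mulIf (monic_neq0 km)).
  by rewrite -[X in _ = _ * X]symmetric_quadratic_reflect -comp_polyM -pE.
have [||s qE] := IH q _ qm qsym.
- apply: leq_trans sm.
  rewrite pE size_monicM ?monic_neq0 // size_symmetric_quadratic.
  by rewrite addn3 /= ltnS leqnSn.
- by move=> w rw; apply: adm; rewrite pE rmorphM rootM rw.
by exists (k :: s); rewrite big_cons pE qE mulrC.
Qed.

(** Over a general field, as multiplicities are read in [algC] and values in [R]. *)
Lemma map_prod_symmetric_quadratic (F : numFieldType) (s : seq nat) :
  map_poly ratr (\prod_(k <- s) symmetric_quadratic k) =
  \prod_(k <- s) (('X - (- k.+1%:R)%:P) * ('X - (k%:R + 2^-1)%:P)) :> {poly F}.
Proof.
rewrite rmorph_prod; apply: eq_bigr => k _.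
rewrite /symmetric_quadratic rmorphM rmorphB rmorphD /= map_polyX !map_polyC /=.
by rewrite ratr_nat rmorphD fmorphV /= !ratr_nat polyCN opprK.
Qed.

(** Each occurrence of k in s contributes a factor X + k + 1, so a bound on root multiplicities
    limits the repetitions in s. *)
Lemma count_le_mup (s : seq nat) (k : nat) :
  (count_mem k s <=
    mup (- k.+1%:R : algC) (map_poly ratr (\prod_(k <- s) symmetric_quadratic k)))%N.
Proof.
rewrite map_prod_symmetric_quadratic.
rewrite mup_geq; last first.
  by rewrite prodf_seq_neq0; apply/allP => i _; rewrite /= mulf_neq0 ?polyXsubC_eq0.
elim: s => [|i s IH]; first by rewrite big_nil dvdpp.
rewrite big_cons /= exprD dvdp_mul //.
by have [->|_] := eqVneq i k; rewrite ?expr1 ?dvdp_mulr ?expr0 ?dvd1p.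
Qed.

(** * From the factorization to the value of the series *)

Theorem corollary2 (R : realType) (p : {poly rat})
    (p_monic : p \is monic)
    (p_nonconstant : (1 < size p)%N)
    (p_even_degree : ~~ odd (size p).-1)
    (p_roots : admissible_simple_or_double_roots p)
    (p_symmetric : p = p \Po ((- 2^-1)%:P - 'X)) :
  cvgn (series (summand R p)) /\
  rational_multiple (limn (series (summand R p))) (1 / pi ^+ 2).
Proof.
have [s pE] : exists s : seq nat, p = \prod_(k <- s) symmetric_quadratic k.
  by apply: symmetric_factorization => // z /p_roots[].
(* An empty product would leave terms of order 1/n, whose series diverges. *)
have s_nil : s != [::].
  by apply: contraTneq p_nonconstant => s0; rewrite pE s0 big_nil size_poly1.
have s_count k : (count_mem k s <= 2)%N.
  have le_mup := count_le_mup s k; rewrite -pE in le_mup.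
  (* The multiplicity bound is given at roots only; a count above 2 forces a positive multiplicity,
     so -(k + 1) is a root. *)
  have [//|c0] := leqP (count_mem k s) 2.
  have /p_roots[_] : root (map_poly ratr p) (- k.+1%:R : algC).
    by apply: contraTT le_mup => /mupNroot ->; rewrite -ltnNge; apply: leq_trans c0.
  by rewrite leqNgt (leq_trans c0 le_mup).
have [q cvq] := pi_rational_quad_prod R s s_nil s_count.
have -> : summand R p = weighted R (fun n => \prod_(k <- s) (quad R k.+1 n)^-1).
  apply/funext => n; rewrite /summand /weighted pE map_prod_symmetric_quadratic.
  rewrite mulrAC; congr (_ * _).
  rewrite horner_prod -prodfV; apply: eq_bigr => k _.
  rewrite !hornerE /quad; congr (_^-1); congr (_ * _); rewrite -(natr1 k); lra.
split; first by apply/cvg_ex; exists (ratr q / pi ^+ 2).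
exists q; rewrite mul1r; exact: cvg_lim.
Qed.
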